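(* For every $n\ge 5$, the graph ($1$-skeleton) of the $n$-dimensional cube is dimensionally ambiguous: there are two polytopes of different dimensions whose $1$-skeleta are both combinatorially equivalent to the $1$-skeleton of the $n$-cube.
   Context: The $k$-skeleton of a convex polytope is the polytopal complex formed by its faces of dimension at most $k$. Two complexes are combinatorially equivalent if their face posets are isomorphic. If a $d$-polytope $P$ and a $d'$-polytope $P'$ with $d\ne d'$ have combinatorially equivalent $k$-skeleta, then this $k$-skeleton is called dimensionally ambiguous. *)

(* Defs.v *)
From HB Require Import structures.
From mathcomp Require Import all_boot all_order all_algebra.
From mathcomp Require Import boolp classical_sets functions cardinality reals.
From mathcomp Require Import convex.

Set Implicit Arguments.
Unset Strict Implicit.
Unset Printing Implicit Defensive.

Import Order.TTheory GRing.Theory Num.Theory.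

Local Open Scope classical_set_scope.
Local Open Scope ring_scope.

(* Points of R^m are row vectors 'rV[R]_m. *)

Definition convex_hull (R : realType) (m : nat) (S : set 'rV[R]_m) :
  set 'rV[R]_m := smallest (@convex_set R 'rV[R]_m) S.

Definition affine_hull (R : realType) (m : nat) (S : set 'rV[R]_m) :
  set 'rV[R]_m :=
  [set y | exists (k : nat) (p : 'I_k -> 'rV[R]_m) (c : 'I_k -> R),
    [/\ forall i, S (p i), \sum_(i < k) c i = 1
      & y = \sum_(i < k) c i *: p i]].

(* The dimension is that of the affine hull, i.e. the linear dimension of its
   direction space V; the empty set has dimension -1, hence the type int. *)
Definition has_dim (R : realType) (m : nat) (S : set 'rV[R]_m) (d : int) :
  Prop :=
  (S = set0 /\ d = -1) \/
  exists (x : 'rV[R]_m) (V : {vspace 'rV[R]_m}),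
    affine_hull S = [set x + v | v in [set v | v \in V]] /\ d = (\dim V)%:Z.

Definition polytope (R : realType) (m : nat) (P : set 'rV[R]_m) : Prop :=
  exists2 S : set 'rV[R]_m, finite_set S & P = convex_hull S.

(* A d-polytope may live in a space R^m with m > d. *)
Definition dpolytope (R : realType) (m : nat) (d : int) (P : set 'rV[R]_m) :
  Prop := polytope P /\ has_dim P d.

Definition dotp (R : realType) (m : nat) (a x : 'rV[R]_m) : R :=
  \sum_(i < m) a 0 i * x 0 i.

(* The faces of P are its intersections with the hyperplanes a.x = b of the
   valid inequalities a.x <= b; since a = 0 is allowed, both P itself (b = 0)
   and the empty set (b = 1) are faces. *)
Definition face (R : realType) (m : nat) (P F : set 'rV[R]_m) : Prop :=
  exists (a : 'rV[R]_m) (b : R),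
    (forall x, P x -> dotp a x <= b) /\ F = P `&` [set x | dotp a x = b].

(* A polytopal complex is given by the collection of its faces, the empty face
   included; the face order is inclusion. *)
Definition skeleton (R : realType) (m : nat) (k : nat) (P : set 'rV[R]_m) :
  set (set 'rV[R]_m) :=
  [set F | face P F /\ exists2 d : int, has_dim F d & d <= k%:Z].

Definition comb_equiv (R : realType) (m m' : nat)
    (C : set (set 'rV[R]_m)) (C' : set (set 'rV[R]_m')) : Prop :=
  exists2 f : set 'rV[R]_m -> set 'rV[R]_m', set_bij C C' f &
    forall F G, C F -> C G -> (f F `<=` f G <-> F `<=` G).

Definition dimensionally_ambiguous (R : realType) (m : nat) (k : nat)
    (C : set (set 'rV[R]_m)) : Prop :=
  exists (m1 m2 : nat) (P1 : set 'rV[R]_m1) (P2 : set 'rV[R]_m2)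
    (d1 d2 : int),
    [/\ dpolytope d1 P1, dpolytope d2 P2, d1 != d2,
        comb_equiv (skeleton k P1) C & comb_equiv (skeleton k P2) C].

Definition cube (R : realType) (n : nat) : set 'rV[R]_n :=
  [set x | forall i : 'I_n, -1 <= x 0 i <= 1].
Arguments cube R n : clear implicits.

(* Main.v *)
Require Import Defs.
From mathcomp Require Import all_boot all_order all_algebra.
From mathcomp Require Import boolp classical_sets functions cardinality reals.
From mathcomp Require Import interval_inference convex ring lra.

(** It suffices to find, for n >= 5, an (n-1)-polytope with the graph of the
    n-cube; the other polytope is the n-cube itself. Deform the n-cube into
    the polytope |x_1|, |x_2| <= (3 - x_0) / 2, |x_3|, |x_4| <= (3 + x_0) / 2,
    |x_0| <= 1, |x_j| <= 1 (j >= 5), and project along x_0. The facet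
    pairs of x_1 and x_2 lean one way, those of x_3 and x_4 the other way. An edge
    lies on facets from all but one of the pairs, hence on facets leaning both
    ways, and so survives the projection. No new edges appear: the edges of
    the n-cube at a vertex span a cone containing the polytope, and
    this is preserved by the projection. *)

Set Implicit Arguments.
Unset Strict Implicit.
Unset Printing Implicit Defensive.

Import Order.TTheory GRing.Theory Num.Theory.

Local Open Scope ring_scope.

(** * Linearity of the dot product *)

Lemma dotp_comb (R : realType) (m : nat) (T : finType) (a : 'rV[R]_m)
    (c : T -> R) (v : T -> 'rV[R]_m) :
  dotp a (\sum_i c i *: v i) = \sum_i c i * dotp a (v i).
Proof.
rewrite /dotp.
under [RHS]eq_bigr do rewrite mulr_sumr.
rewrite [RHS]exchange_big /=; apply: eq_bigr => k _.
rewrite summxE mulr_sumr; apply: eq_bigr => i _.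
by rewrite mxE mulrCA.
Qed.

Lemma dotpDl (R : realType) (m : nat) (a b x : 'rV[R]_m) :
  dotp (a + b) x = dotp a x + dotp b x.
Proof. by rewrite /dotp -big_split; apply: eq_bigr => k _; rewrite mxE mulrDl. Qed.

Lemma dotpB (R : realType) (m : nat) (a x y : 'rV[R]_m) :
  dotp a (x - y) = dotp a x - dotp a y.
Proof. by rewrite /dotp -sumrB; apply: eq_bigr => k _; rewrite !mxE mulrBr. Qed.

Lemma dotpZ (R : realType) (m : nat) (a x : 'rV[R]_m) (s : R) :
  dotp a (s *: x) = s * dotp a x.
Proof. by rewrite /dotp mulr_sumr; apply: eq_bigr => k _; rewrite mxE mulrCA. Qed.

(** * Convex and affine hulls of finite families *)

(** Coefficients range over all of [T] and vanish off [A], so that hulls of different subfamilies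
    share the same sums. *)
Definition hull_on (R : realType) (m : nat) (T : finType) (v : T -> 'rV[R]_m)
    (A : {set T}) : set 'rV[R]_m :=
  [set x | exists c : T -> R,
    [/\ forall i, 0 <= c i, forall i, i \notin A -> c i = 0,
        \sum_i c i = 1 & x = \sum_i c i *: v i]]%classic.

(** The combinatorial form of a face: the indices at which a valid inequality is tight. *)
Definition exposed (R : realType) (m : nat) (T : finType) (v : T -> 'rV[R]_m)
    (A : {set T}) : Prop :=
  exists (a : 'rV[R]_m) (b : R),
    (forall i, dotp a (v i) <= b) /\ A = [set i | dotp a (v i) == b].

Lemma mem_hull_on (R : realType) (m : nat) (T : finType) (v : T -> 'rV[R]_m)
    (A : {set T}) i : i \in A -> hull_on v A (v i).
Proof.
move=> iA; exists (fun j => (j == i)%:R); split.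
- by move=> j; rewrite ler0n.
- by move=> j; case: eqP => // -> /negP.
- by rewrite (bigD1 i) //= eqxx big1 ?addr0 // => j /negbTE ->.
- rewrite (bigD1 i) //= eqxx scale1r big1 ?addr0 // => j /negbTE ->.
  by rewrite scale0r.
Qed.

Lemma hull_onS (R : realType) (m : nat) (T : finType) (v : T -> 'rV[R]_m)
    (A B : {set T}) : A \subset B -> (hull_on v A `<=` hull_on v B)%classic.
Proof.
move=> /fintype.subsetP AB x [c [c0 cA c1 ->]]; exists c; split=> // i iB.
by apply: cA; apply: contra iB => /AB.
Qed.

Lemma hull_on_convex (R : realType) (m : nat) (T : finType)
    (v : T -> 'rV[R]_m) (A : {set T}) : convex_set (hull_on v A).
Proof.
move=> x y l; rewrite !inE => -[c [c0 cA c1 ->]] [e [e0 eA e1 ->]].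
have l0 : 0 <= l%:num by [].
have l1 : 0 <= 1 - l%:num by rewrite subr_ge0.
exists (fun i => l%:num * c i + (1 - l%:num) * e i); split.
- by move=> i; rewrite addr_ge0 ?mulr_ge0.
- by move=> i iA; rewrite cA // eA // !mulr0 addr0.
- by rewrite big_split /= -!mulr_sumr c1 e1 !mulr1 subrKC.
- rewrite /conv /= !scaler_sumr -big_split; apply: eq_bigr => i _ /=.
  by rewrite [RHS]scalerDl -!scalerA.
Qed.

(** Dividing by the total weight lets induction on [s] go through, since the weights of a tail need
    not sum to 1. *)
Lemma convex_comb (R : realType) (m : nat) (T : eqType) (v : T -> 'rV[R]_m)
    (C : set 'rV[R]_m) (c : T -> R) (s : seq T) :
  convex_set C -> (forall i, C (v i)) -> (forall i, 0 <= c i) ->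
  0 < \sum_(i <- s) c i ->
  C ((\sum_(i <- s) c i)^-1 *: \sum_(i <- s) c i *: v i).
Proof.
move=> Cconv Cv c0; elim: s => [|i s IH]; first by rewrite !big_nil ltxx.
rewrite !big_cons => spos.
have [s0|s0] := eqVneq (\sum_(j <- s) c j) 0.
  have z : forall j, j \in s -> c j = 0.
    move=> j js; move/eqP: s0; rewrite psumr_eq0 // => /allP /(_ j js) /eqP.
    by [].
  have -> : \sum_(j <- s) c j *: v j = 0.
    by rewrite big_seq big1 // => j /z ->; rewrite scale0r.
  move: spos; rewrite s0 !addr0 => ci.
  by rewrite scalerA mulVf ?gt_eqF // scale1r.
have spos' : 0 < \sum_(j <- s) c j by rewrite lt_def s0 sumr_ge0.
have := IH spos'; set S := \sum_(j <- s) c j in s0 spos spos' *.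
set V := \sum_(j <- s) _ => CV.
have l0 : 0 <= c i / (c i + S) by rewrite divr_ge0 ?c0 // ltW.
have l1 : c i / (c i + S) <= 1.
  by rewrite ler_pdivrMr // mul1r lerDl ltW.
have := Cconv (v i) (S^-1 *: V) (Itv01 l0 l1).
rewrite !inE => /(_ (Cv i) CV); rewrite /conv /= => H.
suff -> : (c i + S)^-1 *: (c i *: v i + V) =
  (c i / (c i + S)) *: v i + (1 - c i / (c i + S)) *: (S^-1 *: V) by [].
rewrite scalerDr !scalerA [c i / _]mulrC; congr (_ + _ *: _).
by field; rewrite s0 gt_eqF.
Qed.

Lemma convex_hull_range (R : realType) (m : nat) (T : finType)
    (v : T -> 'rV[R]_m) : convex_hull (range v) = hull_on v [set: T].
Proof.
apply/seteqP; split.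
  apply: smallest_sub; first exact: hull_on_convex.
  by move=> _ [i _ <-]; apply: mem_hull_on; rewrite inE.
move=> x [c [c0 _ c1 ->]] C [Cconv Cv].
have := @convex_comb _ _ _ v C c (index_enum T) Cconv.
by rewrite c1 invr1 scale1r; apply => // i; apply: Cv; exists i.
Qed.

(** A weighted average of values at most [b] equals [b] only if every point of nonzero weight
    attains [b]. *)
Lemma hull_on_le (R : realType) (m : nat) (T : finType) (v : T -> 'rV[R]_m)
    (a : 'rV[R]_m) (b : R) (c : T -> R) :
  (forall i, dotp a (v i) <= b) -> (forall i, 0 <= c i) -> \sum_i c i = 1 ->
  dotp a (\sum_i c i *: v i) <= b ?= iff [forall i, (c i == 0) || (dotp a (v i) == b)].
Proof.
move=> le_b c0 c1; rewrite dotp_comb.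
have -> : b = \sum_i c i * b by rewrite -mulr_suml c1 mul1r.
have -> : [forall i, (c i == 0) || (dotp a (v i) == \sum_i c i * b)]
   = [forall (i | true), (c i == 0) || (dotp a (v i) == b)].
  by rewrite -mulr_suml c1 mul1r; apply: eq_forallb.
apply: leif_sum => i _; split; first exact: ler_wpM2l.
by rewrite -subr_eq0 -mulrBr mulf_eq0 subr_eq0.
Qed.

Lemma face_hull_on (R : realType) (m : nat) (T : finType)
    (v : T -> 'rV[R]_m) (F : set 'rV[R]_m) :
  face (hull_on v [set: T]) F <-> exists2 A, exposed v A & F = hull_on v A.
Proof.
have slice (a : 'rV[R]_m) (b : R) : (forall i, dotp a (v i) <= b) ->
  (hull_on v [set: T] `&` [set x | dotp a x = b])%classic =
  hull_on v [set i | dotp a (v i) == b].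
  move=> le_b; apply/seteqP; split=> [x [[c [c0 _ c1 ->]] /= eq_b]|x].
    exists c; split=> // i; rewrite inE => ib.
    have [_] := hull_on_le le_b c0 c1; rewrite eq_b eqxx.
    by move/esym/forallP => /(_ i); rewrite (negbTE ib) orbF => /eqP.
  move=> xA; split; first exact: (hull_onS (finset.subsetT _)) xA.
  move: xA => [c [c0 cA c1 ->]] /=; apply/eqP.
  rewrite (hull_on_le le_b c0 c1); apply/forallP => i.
  by have := cA i; rewrite inE; case: eqP => [//|_ ->]; rewrite ?eqxx ?orbT.
split=> [[a [b [le_b ->]]]|[_ [a [b [le_b ->]]] ->]].
  have le_b' i : dotp a (v i) <= b by apply/le_b/mem_hull_on; rewrite inE.
  by exists [set i | dotp a (v i) == b]; [exists a, b | rewrite slice].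
exists a, b; split; last by rewrite slice.
by move=> _ [c [c0 _ c1 ->]]; rewrite (hull_on_le le_b c0 c1).
Qed.

Lemma exposed0 (R : realType) (m : nat) (T : finType) (v : T -> 'rV[R]_m) :
  exposed v finset.set0.
Proof.
have z x : dotp (0 : 'rV[R]_m) x = 0.
  by rewrite /dotp big1 // => i _; rewrite mxE mul0r.
exists 0, 1; split=> [i|]; first by rewrite z.
by apply/setP => i; rewrite !inE z eq_sym oner_eq0.
Qed.

(** The sum of two valid inequalities is tight exactly where both are. *)
Lemma exposedI (R : realType) (m : nat) (T : finType) (v : T -> 'rV[R]_m)
  (A B : {set T}) : exposed v A -> exposed v B -> exposed v (A :&: B).
Proof.
move=> [a [b [le_b ->]]] [a' [b' [le_b' ->]]].
exists (a + a'), (b + b'); split=> [i|]; first by rewrite dotpDl lerD.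
apply/setP => i; rewrite !inE dotpDl.
have := le_b i; have := le_b' i => le2 le1.
by apply/andP/eqP => [[/eqP-> /eqP->] //|e]; split; apply/eqP; lra.
Qed.

Lemma sub_affine_hull (R : realType) (m : nat) (S : set 'rV[R]_m) x :
  S x -> affine_hull S x.
Proof.
move=> Sx; exists 1%N, (fun=> x), (fun=> 1).
by rewrite !big_ord1 scale1r.
Qed.

Lemma affine_hull_mem (R : realType) (m N : nat) (S : set 'rV[R]_m)
    (x : 'rV[R]_m) (p : 'I_N -> 'rV[R]_m) (c : 'I_N -> R) :
  S x -> (forall k, S (p k)) -> affine_hull S (x + \sum_k c k *: (p k - x)).
Proof.
move=> Sx Sp.
(* The base point [x] is added at index 0 and takes the weight that brings the total to 1. *)
exists N.+1, (fun i => oapp p x (unlift ord0 i)),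
  (fun i => oapp c (1 - \sum_k c k) (unlift ord0 i)); split.
- by move=> i; case: unliftP => [j|] _ /=.
- rewrite big_ord_recl unlift_none /=.
  under [X in _ + X = _]eq_bigr do rewrite liftK /=.
  by rewrite subrK.
- rewrite big_ord_recl unlift_none /=.
  under [X in _ = _ + X]eq_bigr do rewrite liftK /=.
  under [X in _ + X = _]eq_bigr do rewrite scalerBr.
  by rewrite sumrB -scaler_suml scalerBl scale1r addrA addrAC.
Qed.

Lemma affine_hull_sub (R : realType) (m : nat) (S : set 'rV[R]_m)
    (x : 'rV[R]_m) (V : {vspace 'rV[R]_m}) :
  (forall p, S p -> p - x \in V) ->
  forall y, affine_hull S y -> y - x \in V.
Proof.
move=> SV y [k [p [c [Sp c1 ->]]]].
have -> : \sum_i c i *: p i - x = \sum_i c i *: (p i - x).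
  under [RHS]eq_bigr do rewrite scalerBr.
  by rewrite sumrB -scaler_suml c1 scale1r.
by apply: memv_suml => i _; apply: memvZ; apply: SV.
Qed.

Lemma has_dim_full (R : realType) (m N : nat) (S : set 'rV[R]_m)
    (x : 'rV[R]_m) (p : 'I_N -> 'rV[R]_m) :
  S x -> (forall k, S (p k)) ->
  (forall y, exists c : 'I_N -> R, y - x = \sum_k c k *: (p k - x)) ->
  has_dim S m%:Z.
Proof.
move=> Sx Sp full; right; exists x, fullv; split; last first.
  by rewrite dimvf /dim /= mul1n.
apply/seteqP; split=> y.
  by move=> _; exists (y - x); rewrite /= ?memvf // subrKC.
move=> _; have [c e] := full y.
by rewrite -(subrKC x y) e; apply: affine_hull_mem.
Qed.

(** * Realizations of a graph by a finite family of points *)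

(** Conditions under which the 1-skeleton of the hull is the graph [adj]. The last one excludes
    further edges: a face with a second vertex contains an [adj]-edge at each of its vertices. *)
Definition realization (R : realType) (m : nat) (T : finType)
    (v : T -> 'rV[R]_m) (adj : T -> T -> Prop) : Prop :=
  [/\ forall t, exposed v [set t],
      forall t u, adj t u -> exposed v [set t; u]
    & forall A t s, exposed v A -> t \in A -> s \in A -> s != t ->
        exists u, [/\ adj t u, u != t & u \in A]].

(** The case [t = u] yields the vertices. *)
Definition edge_set (T : finType) (adj : T -> T -> Prop) (A : {set T}) : Prop :=
  A = finset.set0 \/ exists t u, (t = u \/ adj t u) /\ A = [set t; u].

(** The functional exposing [i] forces all the weight of a convex combination equal to [v i] onto
    [i]. *)
Lemma mem_hull_onE (R : realType) (m : nat) (T : finType) (v : T -> 'rV[R]_m)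
    (A : {set T}) i :
  exposed v [set i] -> hull_on v A (v i) <-> i \in A.
Proof.
move=> [a [b [le_b e]]]; split; last exact: mem_hull_on.
have iE j : (dotp a (v j) == b) = (j == i).
  by move/setP: e => /(_ j); rewrite !inE.
move=> [c [c0 cA c1 ei]].
have := hull_on_le le_b c0 c1; rewrite -ei => -[_].
rewrite iE eqxx => /esym/forallP z.
have cj j : j != i -> c j = 0.
  by move=> ji; have := z j; rewrite iE (negbTE ji) orbF => /eqP.
apply/negPn/negP => /cA ci; move: c1.
rewrite big1 => [/esym/eqP|j _]; first by rewrite oner_eq0.
by case: (eqVneq j i) => [->|/cj].
Qed.

Lemma hull_on_subE (R : realType) (m : nat) (T : finType) (v : T -> 'rV[R]_m)
    (A B : {set T}) :
  (forall i, exposed v [set i]) ->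
  (hull_on v A `<=` hull_on v B)%classic <-> A \subset B.
Proof.
move=> ext; split; last exact: hull_onS.
move=> AB; apply/fintype.subsetP => i iA.
by apply/(mem_hull_onE B (ext i))/AB/mem_hull_on.
Qed.

Lemma has_dim_edge (R : realType) (m : nat) (T : finType) (v : T -> 'rV[R]_m)
    (t u : T) :
  exists2 d : int, has_dim (hull_on v [set t; u]) d & d <= 1.
Proof.
have tS : hull_on v [set t; u] (v t) by apply: mem_hull_on; rewrite !inE eqxx.
have uS : hull_on v [set t; u] (v u).
  by apply: mem_hull_on; rewrite !inE eqxx orbT.
exists (\dim <[v u - v t]>)%:Z; last by rewrite dim_vline; case: (_ == _).
right; exists (v t), <[v u - v t]>%VS; split=> //.
apply/seteqP; split=> [y yS|_ [w /vlineP[k ->] <-]].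
  exists (y - v t); rewrite /= ?subrKC //.
  apply: affine_hull_sub yS => p [c [c0 cA c1 ->]].
  have -> : \sum_i c i *: v i - v t = \sum_i c i *: (v i - v t).
    under [RHS]eq_bigr do rewrite scalerBr.
    by rewrite sumrB -scaler_suml c1 scale1r.
  apply: memv_suml => i _; case: (boolP (i \in [set t; u])) => [|/cA->].
    rewrite !inE => /orP[]/eqP->; first by rewrite subrr scaler0 mem0v.
    by rewrite memvZ // memv_line.
  by rewrite scale0r mem0v.
have := @affine_hull_mem _ _ 1 _ _ (fun=> v u) (fun=> k) tS (fun=> uS).
by rewrite big_ord1.
Qed.

(* Three points of a line cannot all be vertices, because one of them lies
   between the other two. *)
Lemma edge_set_of_dim (R : realType) (m : nat) (T : finType)
    (v : T -> 'rV[R]_m) (adj : T -> T -> Prop) (A : {set T}) (d : int) :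
  realization v adj -> exposed v A -> has_dim (hull_on v A) d -> d <= 1 ->
  edge_set adj A.
Proof.
move=> [ext _ nbr] Aexp dimA d1.
have [->|/set0Pn[t tA]] := eqVneq A finset.set0; first by left.
right; have [At|] := boolP (A \subset [set t]).
  exists t, t; split; first by left.
  apply/eqP; rewrite finset.eqEsubset finset.setUid At.
  by apply/fintype.subsetP => i /set1P->.
move=> /subsetPn[s sA]; rewrite inE => st.
have [u [tu ut uA]] := nbr A t s Aexp tA sA st.
exists t, u; split; first by right.
apply/eqP; rewrite finset.eqEsubset; apply/andP; split; last first.
  by apply/fintype.subsetP => i /set2P[]->.
apply/fintype.subsetP => l lA; rewrite !inE.
apply/negPn/negP; rewrite negb_or => /andP[lt lu].
case: dimA => [[e _]|[x [V [hullV dV]]]].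
  by have := mem_hull_on v tA; rewrite e.
have memV i : i \in A -> v i - v t \in V.
  have shift j : j \in A -> v j - x \in V.
    move=> jA; have := sub_affine_hull (mem_hull_on v jA); rewrite hullV.
    by move=> [w /= wV <-]; rewrite addrC addKr.
  by move=> /shift iV; have := memvB iV (shift t tA); rewrite opprB addrA subrK.
(* Each vertex is the unique maximizer of some functional. For [u] and [t] this places [v l]
   strictly between them, at parameter [k] in (0, 1); the functional for [l] then gives a
   contradiction. *)
have strict i j : j != i -> exists2 a, dotp a (v j) < dotp a (v i) &
    forall k, k != i -> dotp a (v k) < dotp a (v i).
  move=> ji; have [a [b [le_b /setP e]]] := ext i.
  have ib : dotp a (v i) = b by have := e i; rewrite !inE eqxx => /esym/eqP.
  have lt_b k : k != i -> dotp a (v k) < dotp a (v i).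
    move=> ki; rewrite ib lt_neqAle le_b andbT.
    by have := e k; rewrite !inE (negbTE ki) => <-.
  by exists a => //; apply: lt_b.
have tu' : t != u by rewrite eq_sym.
have ntu : v u - v t != 0.
    have [a lt_a _] := strict u t tu'.
  by apply/eqP => /subr0_eq e; rewrite e ltxx in lt_a.
have eV : (V = <[v u - v t]>)%VS.
  apply/esym/eqP; rewrite eqEdim -memvE memV //= dim_vline ntu.
  by move: d1; rewrite dV.
have /vlineP[k e] : v l - v t \in <[v u - v t]>%VS by rewrite -eV memV.
have eq_k a : dotp a (v l) - dotp a (v t) = k * (dotp a (v u) - dotp a (v t)).
  by rewrite -!dotpB e dotpZ.
have k1 : k < 1.
  have [a ua la] := strict u t tu'.
  have := eq_k a; have := la l lu; nra.
have k0 : 0 < k.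
  have [a _ la] := strict t u ut.
  have := la l lt; rewrite -subr_lt0 eq_k nmulr_llt0 ?subr_lt0 //.
  exact: la.
have tl : t != l by rewrite eq_sym.
have ul : u != l by rewrite eq_sym.
have [a _ la] := strict l t tl.
have := la t tl; have := la u ul.
have := eq_k a; nra.
Qed.

Lemma skeleton1P (R : realType) (m : nat) (T : finType)
    (v : T -> 'rV[R]_m) (adj : T -> T -> Prop) (F : set 'rV[R]_m) :
  realization v adj ->
  skeleton 1 (hull_on v [set: T]) F <->
  exists2 A, edge_set adj A & F = hull_on v A.
Proof.
move=> rv; split=> [[/face_hull_on[A Aexp ->] [d dimA d1]]|[A eA ->]].
  by exists A => //; apply: edge_set_of_dim rv Aexp dimA d1.
have [ext edge _] := rv; split.
  apply/face_hull_on; exists A => //.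
  case: eA => [->|[t [u [[<-|tu] ->]]]]; first exact: exposed0.
    by rewrite finset.setUid.
  exact: edge.
case: eA => [->|[t [u [_ ->]]]]; last exact: has_dim_edge.
exists (-1) => //; left; split=> //.
apply/seteqP; split=> // x [c [_ c0 c1 _]].
move: c1; rewrite big1 => [/esym/eqP|i _]; first by rewrite oner_eq0.
by apply: c0; rewrite inE.
Qed.

Lemma comb_equiv_realization (R : realType) (m m' : nat) (T : finType)
    (v : T -> 'rV[R]_m) (v' : T -> 'rV[R]_m') (adj : T -> T -> Prop) :
  realization v adj -> realization v' adj ->
  comb_equiv (skeleton 1 (hull_on v [set: T]))
             (skeleton 1 (hull_on v' [set: T])).
Proof.
move=> rv rv'; have [ext _ _] := rv; have [ext' _ _] := rv'.
(* The isomorphism reads off the vertex indices of a face and takes the hull of the same indices in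
   the other polytope. *)
pose verts (F : set 'rV[R]_m) : {set T} := [set i | `[< F (v i) >]].
have vertsK A : verts (hull_on v A) = A.
  apply/setP => i; rewrite inE; apply/asboolP/idP => /(mem_hull_onE A (ext i)) //.
exists (fun F => hull_on v' (verts F)).
  split.
  - move=> F /(skeleton1P _ rv)[A eA ->]; apply/(skeleton1P _ rv').
    by exists A; rewrite ?vertsK.
  - move=> F G; rewrite !inE => /(skeleton1P _ rv)[A eA ->].
    move=> /(skeleton1P _ rv)[B eB ->]; rewrite !vertsK => /seteqP[AB BA].
    congr hull_on; apply/eqP; rewrite finset.eqEsubset.
    by apply/andP; split; apply/(hull_on_subE _ _ ext').
  - move=> F /(skeleton1P _ rv')[A eA ->]; exists (hull_on v A).
      by apply/(skeleton1P _ rv); exists A.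
    by rewrite vertsK.
move=> F G /(skeleton1P _ rv)[A eA ->] /(skeleton1P _ rv)[B eB ->].
by rewrite !vertsK (hull_on_subE _ _ ext') (hull_on_subE _ _ ext).
Qed.

(** * Realizations of the cube graph *)

Definition flip (N : nat) (k : 'I_N) (t : {ffun 'I_N -> bool}) :
  {ffun 'I_N -> bool} := [ffun i => (i == k) (+) t i].

Definition cube_adj (N : nat) (t u : {ffun 'I_N -> bool}) : Prop :=
  exists k, u = flip k t.

(** Puts an edge in the form in which [sgn_sum_leif] describes its equality case. *)
Lemma in_edge (N : nat) (k : 'I_N) (t s : {ffun 'I_N -> bool}) :
  s \in [set t; flip k t] = [forall i, (i != k) ==> (s i == t i)].
Proof.
apply/set2P/forallP => [[->|->] i|st].
- by rewrite eqxx implybT.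
- by rewrite ffunE; case: (i == k); rewrite /= ?eqxx.
- have off i : i != k -> s i = t i by move=> ik; apply/eqP/(implyP (st i)).
  have [e|e] := eqVneq (s k) (t k); [left|right]; apply/ffunP => i.
    by have [->//|/off] := eqVneq i k.
  rewrite ffunE; have [->|/off ->] := eqVneq i k; last by [].
  by move: e; case: (s k); case: (t k).
Qed.

(* The cone condition says that every other vertex lies in the cone spanned at
   [v t] by the edges to the neighbours, so a face through [v t] and another
   vertex contains one of these edges. *)
Lemma cube_realization (R : realType) (m N : nat)
    (v : {ffun 'I_N.+2 -> bool} -> 'rV[R]_m) :
  (forall t k, exposed v [set t; flip k t]) ->
  (forall t s, exists2 c : 'I_N.+2 -> R, forall k, 0 <= c k &
     v s - v t = \sum_k c k *: (v (flip k t) - v t)) ->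
  realization v (@cube_adj N.+2).
Proof.
move=> edge cone.
have flip_id k t : flip k t != t.
  by apply/eqP => /ffunP /(_ k); rewrite ffunE eqxx; case: (t k).
have ext t : exposed v [set t].
  (* A vertex is the intersection of two of its edges; [N.+2] makes [ord0] and [ord_max]
     distinct. *)
  have -> : [set t] = [set t; flip ord0 t] :&: [set t; flip ord_max t].
    apply/setP => s; rewrite !inE -orb_andr.
    have [-> //|_] := eqVneq s t; rewrite /=; apply/esym/negP.
    case/andP=> /eqP-> /eqP/ffunP /(_ ord0); rewrite !ffunE eqxx /=.
    by case: (t ord0).
  exact: exposedI.
split=> // [t _ [k ->] //|A t s Aexp tA sA st].
have inj : v s != v t.
  apply/eqP => e; have [a [b [_ /setP eq_ab]]] := ext t.
  have := eq_ab s; have := eq_ab t; rewrite !inE e eqxx => <-.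
  by rewrite (negbTE st).
have [a [b [le_b eA]]] := Aexp.
move: tA sA; rewrite eA !inE => /eqP tb /eqP sb.
have [c c0 ec] := cone t s.
(* The functional [a] agrees on [v s] and [v t], so its slacks at the neighbours, weighted by the
   cone coefficients, sum to 0. All terms are nonnegative, so each vanishes, and a neighbour with
   [c k != 0] lies in [A]. *)
have z : \sum_k c k * (b - dotp a (v (flip k t))) = 0.
  have e : \sum_k c k * dotp a (v (flip k t) - v t) = 0.
    by rewrite -dotp_comb -ec dotpB tb sb subrr.
  apply/oppr_inj; rewrite oppr0 -[RHS]e -sumrN; apply: eq_bigr => k _.
  by rewrite dotpB tb -mulrN opprB.
have zk k : c k * (b - dotp a (v (flip k t))) = 0.
  move/eqP: z; rewrite psumr_eq0 => [/allP /(_ k)|i _].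
    by rewrite mem_index_enum => /(_ isT) /eqP.
  by rewrite mulr_ge0 // subr_ge0.
case: (pselect (exists k, c k != 0)) => [[k ck]|nex].
  exists (flip k t); split; [by exists k|exact: flip_id|].
  rewrite finset.in_set; have /eqP := zk k; rewrite mulf_eq0 (negbTE ck) subr_eq0.
  by rewrite eq_sym.
case/negP: inj; rewrite -subr_eq0 ec big1 // => k _.
have [->|ck] := eqVneq (c k) 0; first by rewrite scale0r.
by case: nex; exists k.
Qed.

Lemma dpolytope_flip_span (R : realType) (m N : nat)
    (v : {ffun 'I_N -> bool} -> 'rV[R]_m) (t : {ffun 'I_N -> bool}) :
  (forall y, exists c : 'I_N -> R,
     y - v t = \sum_k c k *: (v (flip k t) - v t)) ->
  dpolytope m%:Z (hull_on v [set: {ffun 'I_N -> bool}]).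
Proof.
move=> full; split.
  exists (range v); last by rewrite convex_hull_range.
  exact: finite_image.
by apply: (has_dim_full (p := fun k => v (flip k t))) full => [|k];
  apply: mem_hull_on; rewrite inE.
Qed.

Definition sgn (R : realType) (b : bool) : R := (-1) ^+ b.
Arguments sgn {R} b.

Lemma sgnM (R : realType) (b c : bool) :
  sgn b * sgn c = if b == c then 1 else -1 :> R.
Proof. by rewrite /sgn -signr_addb; case: b c => [] []. Qed.

(** Each disagreement of signs costs twice its weight. A zero weight leaves its coordinate free,
    which is how edges get exposed below. *)
Lemma sgn_sum_leif (R : realType) (m : nat) (w : 'I_m -> R) (t s : 'I_m -> bool) :
  (forall j, 0 <= w j) ->
  \sum_j w j * (sgn (t j) * sgn (s j)) <= \sum_j w j
    ?= iff [forall j, (w j != 0) ==> (s j == t j)].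
Proof.
move=> w0; apply: leif_sum => j _; rewrite sgnM eq_sym; split.
  by have := w0 j; case: ifP => _; lra.
have := w0 j; have [->|wn0] := eqVneq (w j) 0; first by rewrite mul0r eqxx.
case: ifP => _ wj /=; first by rewrite mulr1 eqxx.
by apply/eqP => e; move/eqP: wn0; lra.
Qed.

Definition cube_vertex (R : realType) (n : nat) (t : {ffun 'I_n -> bool}) :
  'rV[R]_n := \row_j sgn (t j).
Arguments cube_vertex R {n} t.

Lemma cube_hull_on (R : realType) (n : nat) :
  cube R n = hull_on (cube_vertex R) [set: {ffun 'I_n -> bool}].
Proof.
apply/seteqP; split=> [x xcube|_ [c [c0 _ c1 ->]] j]; last first.
  rewrite summxE -ler_norml; apply: (le_trans (ler_norm_sum _ _ _)).
  rewrite -c1 ler_sum // => t _.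
  by rewrite !mxE normrM normrX normrN1 expr1n mulr1 ger0_norm.
(* The probability of the sign [sgn b] in coordinate [j] when that coordinate has mean [x 0 j]; the
   coefficients are those of the product distribution. *)
pose f j b : R := (1 + sgn b * x 0 j) / 2.
have f0 j b : 0 <= f j b.
  by have /andP[] := xcube j; rewrite /f /sgn; case: b => /=; lra.
exists (fun t : {ffun 'I_n -> bool} => \prod_j f j (t j)); split=> //.
- by move=> t; apply: prodr_ge0.
- by move=> t; rewrite inE.
- rewrite -(bigA_distr_bigA f) big1 // => j _.
  by rewrite big_bool /f /sgn /=; field.
apply/rowP => j; rewrite summxE.
(* The sign of coordinate [j] is absorbed into its factor: after distributing, that factor sums to
   [x 0 j] and all others to 1. *)
pose g i b := f i b * (if i == j then sgn b else 1).
transitivity (\sum_(t : {ffun 'I_n -> bool}) \prod_i g i (t i)).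
  rewrite -(bigA_distr_bigA g) (bigD1 j) //= big_bool big1 => [|i /negbTE ij].
    by rewrite /g eqxx /f /sgn /=; field.
  by rewrite big_bool /g ij /f /sgn /=; field.
apply: eq_bigr => t _; rewrite 2!mxE /g big_split /=; congr (_ * _).
by rewrite (bigD1 j) //= eqxx big1 ?mulr1 // => i /negbTE ->.
Qed.

Lemma cube_vertex_flip (R : realType) (n : nat) (k : 'I_n) t :
  cube_vertex R (flip k t) - cube_vertex R t =
  (- 2 * sgn (t k)) *: delta_mx 0 k.
Proof.
apply/rowP => j; rewrite !mxE ffunE /sgn eqxx /=.
by have [->|_] := eqVneq j k; case: (t _) => /=; ring.
Qed.

Lemma sgn_diff (R : realType) (b c : bool) :
  sgn c - sgn b = (b != c)%:R * (- 2 * sgn b) :> R.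
Proof. by rewrite /sgn; case: b c => [] [] /=; ring. Qed.

Lemma cube_realizes (R : realType) (n : nat) :
  realization (@cube_vertex R n.+2) (@cube_adj n.+2).
Proof.
apply: cube_realization => [t k|t s].
  pose w (j : 'I_n.+2) : R := (j != k)%:R.
  have w0 j : 0 <= w j by rewrite ler0n.
  exists (\row_j (w j * sgn (t j))), (\sum_j w j).
  have aE s : dotp (\row_j (w j * sgn (t j))) (cube_vertex R s) =
      \sum_j w j * (sgn (t j) * sgn (s j)).
    by apply: eq_bigr => j _; rewrite !mxE mulrA.
  split=> [s|]; first by rewrite aE (sgn_sum_leif t s w0).
  apply/setP => s; rewrite in_edge inE aE (sgn_sum_leif t s w0).
  by apply: eq_forallb => j; rewrite /w; case: (j == k); rewrite ?eqxx ?oner_eq0.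
(* The displacement from [t] to [s] is the sum of the edges at [t] in the coordinates where they
   differ. *)
exists (fun k => (t k != s k)%:R) => [k|]; first by rewrite ler0n.
rewrite {1}[_ - _]row_sum_delta; apply: eq_bigr => k _.
by rewrite cube_vertex_flip !mxE sgn_diff scalerA.
Qed.

Lemma cube_dpolytope (R : realType) (n : nat) :
  dpolytope n%:Z (hull_on (@cube_vertex R n) [set: {ffun 'I_n -> bool}]).
Proof.
apply: (@dpolytope_flip_span _ _ _ _ [ffun=> false]) => y.
set v0 := cube_vertex R _.
(* All signs of [v0] are +1, so its edge in direction [k] is -2 times the basis vector. *)
exists (fun k => (y - v0) 0 k / - 2).
rewrite {1}[_ - _]row_sum_delta; apply: eq_bigr => k _.
rewrite cube_vertex_flip scalerA ffunE /sgn expr0; congr (_ *: _).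
by field.
Qed.

(** * The projected deformed cube *)

(* Half-lengths of the box over the end [b] of the deformed coordinate. *)
Definition half_len (R : realType) (j : nat) (b : bool) : R :=
  if (j < 4)%N then (if (j < 2)%N == b then 2 else 1) else 1.
Arguments half_len R j b : clear implicits.

(** The bit [t ord0] belongs to the direction projected away; it survives only through the
    half-lengths. *)
Definition deformed_vertex (R : realType) (m : nat)
    (t : {ffun 'I_m.+1 -> bool}) : 'rV[R]_m :=
  \row_j (sgn (t (lift ord0 j)) * half_len R j (t ord0)).
Arguments deformed_vertex R {m} t.

Lemma half_len_gt0 (R : realType) j b : 0 < half_len R j b.
Proof. by rewrite /half_len; do 2?case: ifP => _; lra. Qed.

(** Over either end, two of the first four half-lengths are 2 and two are 1. This tie exposes the
    edges in the projected direction. *)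
Lemma sum_half_len (R : realType) (k : nat) (b c : bool) :
  \sum_(j < k.+4) half_len R j b = \sum_(j < k.+4) half_len R j c.
Proof.
rewrite !big_ord_recl /half_len /=.
by case: b c => [] [] /=; ring.
Qed.

(* Over the other end the weighted sum drops, since the sum over all [j] drops
   by [2 * 4 - 2 * 1] and a single term by at most [4]. *)
Lemma sum_half_len_lt (R : realType) (k : nat) (b : bool) (i : 'I_k.+4) :
  \sum_(j < k.+4) (j != i)%:R * half_len R j b ^+ 2 * half_len R j (~~ b) <
  \sum_(j < k.+4) (j != i)%:R * half_len R j b ^+ 2 * half_len R j b.
Proof.
rewrite -subr_gt0 -sumrB.
pose D (j : nat) : R := half_len R j b ^+ 2 * (half_len R j b - half_len R j (~~ b)).
have sumD : \sum_(j < k.+4) D j = 6.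
  rewrite !big_ord_recl big1 /D /half_len /=; last by move=> j _; ring.
  by case: b {D} => /=; ring.
have D4 j : D j <= 4.
  by rewrite /D /half_len; case: (j < 4)%N (j < 2)%N b {D sumD} => [] [] [] /=; lra.
under eq_bigr => j _ do rewrite -mulrBr -mulrA -/(D j).
rewrite (bigD1 i) //= eqxx mul0r add0r.
under eq_bigr => j ji do rewrite ji mul1r.
by move: sumD; rewrite (bigD1 i) //=; have := D4 i; lra.
Qed.

Lemma deformed_vertex_flip0 (R : realType) (m : nat)
    (t : {ffun 'I_m.+1 -> bool}) (j : 'I_m) :
  (deformed_vertex R (flip ord0 t) - deformed_vertex R t) 0 j =
  sgn (t (lift ord0 j)) * (half_len R j (~~ t ord0) - half_len R j (t ord0)).
Proof. by rewrite !mxE !ffunE /= mulrBr. Qed.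

Lemma deformed_vertex_flip (R : realType) (m : nat)
    (t : {ffun 'I_m.+1 -> bool}) (k : 'I_m) :
  deformed_vertex R (flip (lift ord0 k) t) - deformed_vertex R t =
  (- 2 * sgn (t (lift ord0 k)) * half_len R k (t ord0)) *: delta_mx 0 k.
Proof.
apply/rowP => j; rewrite !mxE !ffunE /sgn eqxx /= (inj_eq lift_inj).
by have [->|_] := eqVneq j k; case: (t _) => /=; ring.
Qed.

Lemma dotp_deformed (R : realType) (m : nat) (w : 'I_m -> R)
    (t s : {ffun 'I_m.+1 -> bool}) :
  dotp (\row_j (w j * sgn (t (lift ord0 j)))) (deformed_vertex R s) =
  \sum_j w j * half_len R j (s ord0) *
    (sgn (t (lift ord0 j)) * sgn (s (lift ord0 j))).
Proof. by apply: eq_bigr => j _; rewrite !mxE; ring. Qed.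

(** In the projected direction, the plain sign functional of [t] has the same maximum over both
    ends. For any other edge, weights are chosen to favour the end containing it. *)
Lemma deformed_edge (R : realType) (k : nat) (t : {ffun 'I_k.+4.+1 -> bool}) i :
  exposed (deformed_vertex R) [set t; flip i t].
Proof.
pose T := {ffun 'I_k.+4.+1 -> bool}.
pose tl (s : T) (j : 'I_k.+4) : bool := s (lift ord0 j).
case: (unliftP ord0 i) => [i'|] ->; last first.
  exists (\row_j (1 * sgn (tl t j))), (\sum_(j < k.+4) half_len R j (t ord0)).
  have le (s : T) := @sgn_sum_leif R _ (fun j : 'I_k.+4 => half_len R j (s ord0))
    (tl t) (tl s) (fun j => ltW (half_len_gt0 _ _ _)).
  have aE (s : T) : dotp (\row_j (1 * sgn (tl t j))) (deformed_vertex R s) =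
    \sum_(j < k.+4) half_len R j (s ord0) * (sgn (tl t j) * sgn (tl s j)).
    by rewrite dotp_deformed; under eq_bigr do rewrite mul1r.
  split=> [s|]; first by rewrite aE (sum_half_len R _ _ (s ord0)) (le s).
  apply/setP => s; rewrite in_edge inE aE (sum_half_len R _ _ (s ord0)) (le s).
  apply/forallP/forallP => st j.
    by rewrite (implyP (st (lift ord0 j))) ?implybT // eq_sym neq_lift.
  case: (unliftP ord0 j) => [j'|] -> //; apply/implyP => _.
  by apply: (implyP (st j')); rewrite gt_eqF ?half_len_gt0.
(* Weight 0 at [i'] makes both vertices of the edge tight. The squares make the end of [t] win
   strictly; first powers could tie, since the total drop 2 * 2 - 2 * 1 may be cancelled by omitting
   a term equal to 2. *)
pose w (j : 'I_k.+4) := (j != i')%:R * half_len R j (t ord0) ^+ 2.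
pose W (s : T) j := w j * half_len R j (s ord0).
have W0 s j : 0 <= W s j.
  by rewrite !mulr_ge0 ?ler0n ?exprn_ge0 // ltW // half_len_gt0.
have Wn0 s j : (W s j != 0) = (j != i').
  have p : 0 < half_len R j (t ord0) ^+ 2 * half_len R j (s ord0).
    by rewrite mulr_gt0 ?exprn_gt0 // half_len_gt0.
  rewrite /W /w -mulrA mulf_eq0 (gt_eqF p) orbF.
  by case: (j == i'); rewrite ?eqxx ?oner_eq0.
have le (s : T) := sgn_sum_leif (tl t) (tl s) (W0 s).
have lt (s : T) : s ord0 != t ord0 -> \sum_j W s j < \sum_j W t j.
  by move=> /negbTE st; have := sum_half_len_lt R (t ord0) i';
    rewrite /W /w; case: (s ord0) (t ord0) st => [] [].
exists (\row_j (w j * sgn (tl t j))), (\sum_j W t j); split=> [s|].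
  rewrite dotp_deformed; apply: (le_trans (le s)).
  have [e|/lt/ltW//] := eqVneq (s ord0) (t ord0).
  by rewrite /W e.
apply/setP => s; rewrite in_edge inE dotp_deformed.
have [e|/[dup] st /lt lt_s] := eqVneq (s ord0) (t ord0); last first.
  rewrite lt_eqF ?(le_lt_trans (le s)) //; apply/forallP => /(_ ord0).
  by rewrite neq_lift (negbTE st).
have -> : \sum_j W t j = \sum_j W s j by rewrite /W e.
rewrite (le s); apply/forallP/forallP => st j.
  by rewrite Wn0; apply/implyP => ji; apply: (implyP (st (lift ord0 j)));
    rewrite (inj_eq lift_inj).
case: (unliftP ord0 j) => [j'|] ->; last by rewrite e eqxx implybT.
by rewrite (inj_eq lift_inj) -(Wn0 s).
Qed.

Lemma deformed_cone (R : realType) (m : nat) (t s : {ffun 'I_m.+1 -> bool}) :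
  exists2 c : 'I_m.+1 -> R, forall k, 0 <= c k &
    deformed_vertex R s - deformed_vertex R t =
    \sum_k c k *: (deformed_vertex R (flip k t) - deformed_vertex R t).
Proof.
pose r j := half_len R j (s ord0) / half_len R j (t ord0).
(* Change ends first if needed, keeping the other signs. The remaining edges, over the end of [s],
   are parallel to those at [t] and scaled by [r]. *)
exists (fun k => oapp (fun j : 'I_m => (t k != s k)%:R * r j)
                  (t k != s k)%:R (unlift ord0 k)).
  move=> k; case: (unlift ord0 k) => [j|] /=; last exact: ler0n.
  by rewrite mulr_ge0 ?ler0n // divr_ge0 // ltW // half_len_gt0.
rewrite big_ord_recl unlift_none /=.
under eq_bigr do rewrite liftK /= deformed_vertex_flip scalerA.
apply/rowP => j; rewrite [RHS]mxE [X in _ = X + _]mxE deformed_vertex_flip0 summxE.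
rewrite (bigD1 j) //= big1 ?addr0 => [|i ij].
  rewrite !mxE !eqxx /= /r.
  have h0 : half_len R j (t ord0) != 0 by rewrite gt_eqF ?half_len_gt0.
  have -> : sgn (s (lift ord0 j)) = sgn (t (lift ord0 j)) +
    (t (lift ord0 j) != s (lift ord0 j))%:R * (- 2 * sgn (t (lift ord0 j))) :> R.
    by rewrite -sgn_diff subrKC.
  have [e|st] := eqVneq (t ord0) (s ord0).
    by rewrite /= -e; field.
  have -> : s ord0 = ~~ t ord0 by case: (s ord0) (t ord0) st => [] [].
  by rewrite /=; field.
by rewrite !mxE (eq_sym j) (negbTE ij) andbF mulr0.
Qed.

Lemma deformed_realizes (R : realType) (k : nat) :
  realization (@deformed_vertex R k.+4) (@cube_adj k.+4.+1).
Proof.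
by apply: cube_realization => [t i|]; [apply: deformed_edge|apply: deformed_cone].
Qed.

Lemma deformed_dpolytope (R : realType) (m : nat) :
  dpolytope m%:Z
    (hull_on (@deformed_vertex R m) [set: {ffun 'I_m.+1 -> bool}]).
Proof.
apply: (@dpolytope_flip_span _ _ _ _ [ffun=> false]) => y.
set v0 := deformed_vertex R _.
(* The edges over the end [false] are nonzero multiples of all basis vectors, so the projected edge
   gets coefficient 0. *)
exists (fun k => oapp (fun j : 'I_m => (y - v0) 0 j / (- 2 * half_len R j false))
                  0 (unlift ord0 k)).
rewrite big_ord_recl unlift_none /= scale0r add0r.
rewrite {1}[y - _]row_sum_delta; apply: eq_bigr => k _.
rewrite liftK /= deformed_vertex_flip scalerA !ffunE /sgn expr0.
congr (_ *: _); field; rewrite gt_eqF ?half_len_gt0 //.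
Qed.

Theorem mainTheorem4 (R : realType) (n : nat) (hn : (5 <= n)%N) :
  dimensionally_ambiguous 1 (skeleton 1 (cube R n)).
Proof.
(* With [n] equal to [k + 5], the projection keeps [k + 4] coordinates, enough for the four of
   varying half-length. *)
case: n hn => [|[|[|[|[|k]]]]] // _.
rewrite cube_hull_on.
exists k.+4.+1, k.+4, (hull_on (@cube_vertex R k.+4.+1) [set: _]),
  (hull_on (@deformed_vertex R k.+4) [set: _]), k.+4.+1%:Z, k.+4%:Z.
split.
- exact: cube_dpolytope.
- exact: deformed_dpolytope.
- by rewrite eqz_nat eqn_leq ltnn.
- by apply: comb_equiv_realization; apply: cube_realizes.
- apply: comb_equiv_realization; first exact: deformed_realizes.
  exact: cube_realizes.
Qed.
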